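(* Let $X$ be a flat Hadamard space with linear dual space $X^{\lozenge}$, and let $p\in X$. Then a set-valued operator $T:X\multimap X^{\lozenge}$ is maximal monotone if and only if there exists a unique $h\in\Gamma_p^{\lozenge}(X)$ such that $T=S_{h,p}$, where $S_{h,p}(x):=\{x^{\lozenge}\in X^{\lozenge}:h(x,x^{\lozenge})=\pi_p(x,x^{\lozenge})\}$ for $x\in X$.
   Context: A Hadamard space is a (nonempty) complete $\mathrm{CAT}(0)$ space $(X,d)$. For $x,y\in X$ and $t\in[0,1]$, $(1-t)x\oplus ty$ denotes the point $c(t)$ of the unique constant-speed geodesic $c:[0,1]\to X$ from $x$ to $y$. $X$ is flat if $d(z,(1-t)x\oplus ty)^2=(1-t)d(z,x)^2+td(z,y)^2-t(1-t)d(x,y)^2$ for all $x,y,z\in X$, $t\in[0,1]$. Quasilinearization: for $x,y,u,v\in X$, $\langle\overrightarrow{xy},\overrightarrow{uv}\rangle:=\frac12\big(d(x,v)^2+d(y,u)^2-d(x,u)^2-d(y,v)^2\big)$. Dual spaces: for $t\in\mathbb R$, $a,b\in X$, $[t\overrightarrow{ab}]$ is the class of $(t,a,b)\in\mathbb R\times X^2$ under the relation $(t,a,b)\sim(s,c,d)$ iff $t\langle\overrightarrow{ab},\overrightarrow{xy}\rangle=s\langle\overrightarrow{cd},\overrightarrow{xy}\rangle$ for all $x,y\in X$; it is identified with the function $\overrightarrow{xy}\mapsto t\langle\overrightarrow{ab},\overrightarrow{xy}\rangle$ on $X^2$. $X^*$ is the set of all such classes, and the linear dual $X^{\lozenge}$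 is the real vector space of all finite linear combinations $\sum_i\alpha_i x_i^*$ ($\alpha_i\in\mathbb R$, $x_i^*\in X^*$), acting on $X^2$ by $\langle\sum_i\alpha_ix_i^*,\overrightarrow{xy}\rangle=\sum_i\alpha_i\langle x_i^*,\overrightarrow{xy}\rangle$ (elements with the same action are equal). $X^{\lozenge}$ carries the norm $\|x^{\lozenge}\|_{\lozenge}=\sup\Big\{\frac{|\langle x^{\lozenge},\overrightarrow{ab}\rangle-\langle x^{\lozenge},\overrightarrow{cd}\rangle|}{d(a,b)+d(c,d)}: a,b,c,d\in X,\ (a,c)\ne(b,d)\Big\}$, and $X\times X^{\lozenge}$ the product topology. For $h:X\times X^{\lozenge}\to[-\infty,\infty]$: $h$ is proper if it never takes the value $-\infty$ and $h\not\equiv\infty$; l.s.c. if its epigraph is closed; convex if $h((1-\lambda)x\oplus\lambda y,(1-\lambda)x^{\lozenge}+\lambda y^{\lozenge})\le(1-\lambda)h(x,x^{\lozenge})+\lambda h(y,y^{\lozenge})$ for all $(x,x^{\lozenge}),(y,y^{\lozenge})$ and $\lambda\in[0,1]$. $\Gamma(X\times X^{\lozenge})$ is the set of proper, l.s.c., convex $h:X\times X^{\lozenge}\to[-\infty,\infty]$. Fix $p\in X$. $\pi_p(x,x^{\lozenge}):=\langle x^{\lozenge},\overrightarrow{px}\rangle$ on $X\times X^{\lozenge}$; $r(x,x^{\lozenge}):=(x^{\lozenge},x)$. The indicator $\iota_A$ equals $0$ on $A$ and $\infty$ off $A$. $\{h\le\pi_p\}:=\{(x,x^{\lozenge}):h(x,x^{\lozenge})\le\pi_p(x,x^{\lozenge})\}$.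 The $p$-Fenchel conjugate $h_p^{\lozenge}:X^{\lozenge}\times X\to[-\infty,\infty]$ is $$h_p^{\lozenge}(x^{\lozenge},x)=\sup_{(y,y^{\lozenge})\in X\times X^{\lozenge}}\{\langle x^{\lozenge},\overrightarrow{py}\rangle+\langle y^{\lozenge},\overrightarrow{px}\rangle-h(y,y^{\lozenge})\}.$$ $\Gamma_p^{\lozenge}(X):=\{h\in\Gamma(X\times X^{\lozenge}): h=(h+\iota_{\{h\le\pi_p\}})_p^{\lozenge}\circ r\text{ on }X\times X^{\lozenge}\}$. For a set-valued operator $T:X\multimap X^{\lozenge}$ (a map assigning to each $x\in X$ a possibly empty subset $T(x)\subseteq X^{\lozenge}$), $\mathrm{gra}(T)=\{(x,x^{\lozenge}):x^{\lozenge}\in T(x)\}$. $T$ is monotone if $\langle x^{\lozenge}-y^{\lozenge},\overrightarrow{yx}\rangle\ge0$ for all $(x,x^{\lozenge}),(y,y^{\lozenge})\in\mathrm{gra}(T)$; it is maximal monotone if it is monotone and no monotone operator has a graph properly containing $\mathrm{gra}(T)$. *)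

(* Defs.v *)
From HB Require Import structures.
From mathcomp Require Import all_boot all_order all_algebra.
From mathcomp Require Import all_classical all_reals all_analysis.
From mathcomp Require Import ring lra.

Set Implicit Arguments.
Unset Strict Implicit.
Unset Printing Implicit Defensive.

Import Order.TTheory GRing.Theory Num.Theory.
Import numFieldNormedType.Exports.

Local Open Scope classical_set_scope.
Local Open Scope ring_scope.

Section Geodesics.
Context {R : realType} {X : metricType R}.
Implicit Types (x y z : X) (c : R -> X).

Definition geodesic c x y : Prop :=
  [/\ c 0 = x, c 1 = y &
    forall s t, 0 <= s <= 1 -> 0 <= t <= 1 ->
      mdist (c s) (c t) = `|s - t| * mdist x y].

End Geodesics.

(* The norm that the library puts on R^o * R^o is the sup norm, so the
   Euclidean distance of the model plane is written out. *)
Definition edist {R : realType} (u v : R^o * R^o) : R :=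
  Num.sqrt ((u.1 - v.1) ^+ 2 + (u.2 - v.2) ^+ 2).

Section CAT0.
Context {R : realType}.

(* The CAT(0) inequality for geodesic triangles.  Any two distinct sides share
   a vertex, here called x, and for two points on the same side the inequality
   is an equality; quantifying over all x, y, z therefore covers all pairs of
   points of a triangle.  The third side is not used. *)
Definition cat0 (X : metricType R) : Prop :=
  (forall x y : X, exists c : R -> X, geodesic c x y) /\
  (forall (x y z : X) (c1 c2 : R -> X),
     geodesic c1 x y -> geodesic c2 x z ->
   forall x' y' z' : R^o * R^o,
     edist x' y' = mdist x y -> edist x' z' = mdist x z ->
     edist y' z' = mdist y z ->
   forall s t : R, 0 <= s <= 1 -> 0 <= t <= 1 ->
     mdist (c1 s) (c2 t) <=
     edist ((1 - s) *: x' + s *: y') ((1 - t) *: x' + t *: z')).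

End CAT0.

HB.mixin Record Metric_isCAT0 (R : realType) X & Metric R X := {
  cat0P : cat0 X
}.

(* Complete types are pointed in the library, hence nonempty. *)
#[short(type="hadamardType")]
HB.structure Definition Hadamard (R : realType) :=
  { X of Metric R X & Complete X & Metric_isCAT0 R X }.

Section ConvexCombination.
Context {R : realType} {X : hadamardType R}.
Implicit Types (x y z : X) (t : R).

Lemma geodesic_exists x y : exists c : R -> X, geodesic c x y.
Proof. by have [+ _] := @cat0P R X; exact. Qed.

(* gconv t x y is (1 - t) x (+) t y; the choice of the geodesic is immaterial
   by geodesic_unique below. *)
Definition gconv t x y : X := projT1 (cid (geodesic_exists x y)) t.

Lemma gconv_geodesic x y : geodesic (fun t => gconv t x y) x y.
Proof. exact: projT2 (cid (geodesic_exists x y)). Qed.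

Definition flat : Prop := forall x y z t, 0 <= t <= 1 ->
  mdist z (gconv t x y) ^+ 2 =
  (1 - t) * mdist z x ^+ 2 + t * mdist z y ^+ 2
  - t * (1 - t) * mdist x y ^+ 2.

Lemma comparison_triangle x y z : exists x' y' z' : R^o * R^o,
  [/\ edist x' y' = mdist x y, edist x' z' = mdist x z &
      edist y' z' = mdist y z].
Proof.
have t1 := metric_triangle x y z.
have t2 := metric_triangle x z y.
have t3 := metric_triangle y x z.
rewrite (metric_sym y x) (metric_sym z y) in t2 t3.
have := mdist_ge0 x y; have := mdist_ge0 x z; have := mdist_ge0 y z.
move: (mdist x y) (mdist x z) (mdist y z) t1 t2 t3 => a b c t1 t2 t3 c0 b0 a0.
have [a_eq0|a_neq0] := eqVneq a 0.
  exists (0, 0), (0, 0), (b, 0); rewrite /edist /= a_eq0.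
  have -> : c = b by lra.
  by split; rewrite ?subrr ?sub0r ?sqrrN ?expr0n /= ?addr0 ?sqrtr0 // sqrtr_sqr
    ger0_norm.
have a_gt0 : 0 < a by rewrite lt_neqAle eq_sym a_neq0.
pose u := (a ^+ 2 + b ^+ 2 - c ^+ 2) / (2 * a).
have eu : 2 * a * u = a ^+ 2 + b ^+ 2 - c ^+ 2 by rewrite /u; field.
have ub : u <= b.
  by rewrite /u ler_pdivrMr; [nra|lra].
have lb : - b <= u.
  by rewrite /u ler_pdivlMr; [nra|lra].
have v0 : 0 <= b ^+ 2 - u ^+ 2 by nra.
exists (0, 0), (a, 0), (u, Num.sqrt (b ^+ 2 - u ^+ 2)); rewrite /edist /=.
split.
- by rewrite subrr sub0r sqrrN expr0n /= addr0 sqrtr_sqr ger0_norm.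
- rewrite !sub0r !sqrrN sqr_sqrtr //.
  have -> : u ^+ 2 + (b ^+ 2 - u ^+ 2) = b ^+ 2 by ring.
  by rewrite sqrtr_sqr ger0_norm.
- rewrite !sub0r !sqrrN sqr_sqrtr //.
  have -> : (a - u) ^+ 2 + (b ^+ 2 - u ^+ 2) = c ^+ 2 by move: eu; lra.
  by rewrite sqrtr_sqr ger0_norm.
Qed.

Lemma edist_sqr (u v : R^o * R^o) :
  edist u v ^+ 2 = (u.1 - v.1) ^+ 2 + (u.2 - v.2) ^+ 2.
Proof. by rewrite /edist sqr_sqrtr // addr_ge0 // sqr_ge0. Qed.

Lemma cat0_cn x y z (c : R -> X) t : geodesic c x y -> 0 <= t <= 1 ->
  mdist z (c t) ^+ 2 <=
  (1 - t) * mdist z x ^+ 2 + t * mdist z y ^+ 2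
  - t * (1 - t) * mdist x y ^+ 2.
Proof.
move=> gc t01; have [x' [y' [z' [exy exz eyz]]]] := comparison_triangle x y z.
have [_ cat] := @cat0P R X.
have gz := gconv_geodesic x z.
have h11 : 0 <= (1 : R) <= 1 by lra.
have := cat _ _ _ _ _ gc gz _ _ _ exy exz eyz _ _ t01 h11.
have [_ -> _] := gz.
rewrite (metric_sym (c t)) => le1.
have le2 : mdist z (c t) ^+ 2 <=
    edist ((1 - t) *: x' + t *: y') ((1 - 1) *: x' + 1 *: z') ^+ 2.
  by rewrite lerXn2r // nnegrE ?mdist_ge0 // sqrtr_ge0.
rewrite (le_trans le2) // (metric_sym z x) (metric_sym z y) -exy -exz -eyz.
rewrite !edist_sqr /= le_eqVlt; apply/orP; left; apply/eqP.
rewrite /GRing.scale /=; ring.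
Qed.

Lemma geodesic_unique x y (c : R -> X) t :
  geodesic c x y -> 0 <= t <= 1 -> c t = gconv t x y.
Proof.
move=> gc t01; apply/esym/mdist_positivity/eqP.
have := cat0_cn (gconv t x y) gc t01.
have [g0 g1 g] := gconv_geodesic x y.
have h00 : 0 <= (0 : R) <= 1 by lra.
have h11 : 0 <= (1 : R) <= 1 by lra.
have := g _ _ t01 h00; have := g _ _ t01 h11.
rewrite g0 g1 subr0 => -> ->.
rewrite !exprMn !real_normK ?num_real // => le0.
by rewrite -sqrf_eq0 eq_le sqr_ge0 andbT (le_trans le0) // le_eqVlt;
  apply/orP; left; apply/eqP; ring.
Qed.

End ConvexCombination.

Arguments flat {R} X.

Section Dual.
Context {R : realType} {X : hadamardType R}.
Implicit Types (a b c d x y u v : X).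

Definition qlin x y u v : R :=
  (mdist x v ^+ 2 + mdist y u ^+ 2 - mdist x u ^+ 2 - mdist y v ^+ 2) / 2.

(* The class of (t, a, b), identified with its action on X * X: equality of
   functions is the equivalence of the triples. *)
Definition dual_class (t : R) a b : X * X -> R^o :=
  fun xy => t * qlin a b xy.1 xy.2.

Definition dual_space : set (X * X -> R^o) :=
  [set f | exists t a b, f = dual_class t a b].

Definition linear_dual : set (X * X -> R^o) :=
  [set f | exists (n : nat) (al : 'I_n -> R) (g : 'I_n -> X * X -> R^o),
    (forall i, dual_space (g i)) /\ f = \sum_(i < n) al i *: g i].

Definition linear_dual_pred : {pred X * X -> R^o} := mem linear_dual.

Lemma linear_dual_submod_closed : submod_closed linear_dual_pred.
Proof.
split.
  apply/mem_set; exists 0, (fun=> 0), (fun=> 0).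
  by split=> [[]//|]; rewrite big_ord0.
move=> k f1 f2 /set_mem[n [al [g [gD ->]]]] /set_mem[m [be [h [hD ->]]]].
apply/mem_set; exists (n + m)%N.
exists (fun i : 'I_(n + m) => match fintype.split i with inl j => k * al j | inr j => be j end).
exists (fun i : 'I_(n + m) => match fintype.split i with inl j => g j | inr j => h j end).
split=> [i|]; first by case: (fintype.split i).
rewrite big_split_ord /= scaler_sumr; congr (_ + _); apply: eq_bigr => i _.
  by rewrite (unsplitK (inl i)) scalerA.
by rewrite (unsplitK (inr i)).
Qed.

HB.instance Definition _ :=
  GRing.isSubmodClosed.Build _ _ linear_dual_pred linear_dual_submod_closed.

End Dual.

Record linDual (R : realType) (X : hadamardType R) := LinDual {
  linDual_fun :> X * X -> R^o;
  _ : linDual_fun \in linear_dual_pred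
}.

HB.instance Definition _ (R : realType) (X : hadamardType R) :=
  [isSub for @linDual_fun R X].
HB.instance Definition _ (R : realType) (X : hadamardType R) :=
  [Choice of linDual X by <:].
HB.instance Definition _ (R : realType) (X : hadamardType R) :=
  [SubChoice_isSubLmodule of linDual X by <:].

Section Pairing.
Context {R : realType} {X : hadamardType R}.

Definition pairing (f : linDual X) (x y : X) : R := f (x, y).

Lemma pairingD f g x y : pairing (f + g) x y = pairing f x y + pairing g x y.
Proof. by []. Qed.

Lemma pairingB f g x y : pairing (f - g) x y = pairing f x y - pairing g x y.
Proof. by []. Qed.

Lemma pairingZ k f x y : pairing (k *: f) x y = k * pairing f x y.
Proof. by []. Qed.

Lemma linDual_ext f g : (forall x y, pairing f x y = pairing g x y) -> f = g.
Proof. by move=> fg; apply/val_inj/funext => -[x y]; exact: fg. Qed.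

End Pairing.

Section DualNorm.
Context {R : realType} {X : hadamardType R}.
Implicit Types (a b c d x y : X) (f g : linDual X).

Lemma quadrilateral a b c d : qlin a b c d <= mdist a b * mdist c d.
Proof.
suff : mdist a d ^+ 2 + mdist b c ^+ 2 <=
    mdist a c ^+ 2 + mdist b d ^+ 2 + 2 * (mdist a b * mdist c d).
  by rewrite /qlin; lra.
have [ab0|ab0] := eqVneq (mdist a b) 0.
  by rewrite (mdist_positivity _ _ ab0) mdistxx; lra.
have [cd0|cd0] := eqVneq (mdist c d) 0.
  by rewrite (mdist_positivity _ _ cd0) mdistxx; lra.
have pab : 0 < mdist a b by rewrite lt_neqAle eq_sym ab0 mdist_ge0.
have pcd : 0 < mdist c d by rewrite lt_neqAle eq_sym cd0 mdist_ge0.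
(* bound d(a, d) through the point of [b, c] at parameter s below *)
pose D := mdist a b + mdist c d.
have D0 : 0 < D by rewrite addr_gt0.
pose s := mdist a b / D.
have s0 : 0 < s by rewrite divr_gt0.
have s1 : 0 < 1 - s.
  have -> : 1 - s = mdist c d / D by rewrite /s /D; field; rewrite gt_eqF.
  by rewrite divr_gt0.
have s01 : 0 <= s <= 1 by lra.
have gbc := gconv_geodesic b c.
have A := cat0_cn a gbc s01.
have B := cat0_cn d gbc s01.
have T := metric_triangle a (gconv s b c) d.
have T2 := mdist_ge0 a d.
have eD : D * s = mdist a b by rewrite /s mulrC divfK // gt_eqF.
have eD1 : D * (1 - s) = mdist c d by rewrite mulrBr mulr1 eD /D; ring.
rewrite (metric_sym (gconv s b c) d) in T.
rewrite (metric_sym d b) (metric_sym d c) in B.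
have U0 := mdist_ge0 a (gconv s b c).
have V0 := mdist_ge0 d (gconv s b c).
move: (mdist a d) (mdist a (gconv s b c)) (mdist d (gconv s b c))
  T T2 A B U0 V0 => q U V T T2 A B U0 V0.
move: (mdist a c) (mdist b d) (mdist b c) A B => ac bd bc A B.
rewrite -eD -eD1 in A B *.
have Q : s * (1 - s) * q ^+ 2 <= (1 - s) * U ^+ 2 + s * V ^+ 2.
  have q2 : q ^+ 2 <= (U + V) ^+ 2.
    by rewrite -subr_ge0 subr_sqr mulr_ge0 //; move: T T2 U0 V0; lra.
  have : s * (1 - s) * q ^+ 2 <= s * (1 - s) * (U + V) ^+ 2.
    by rewrite ler_pM2l // mulr_gt0.
  move=> /le_trans; apply; rewrite -subr_ge0.
  suff -> : (1 - s) * U ^+ 2 + s * V ^+ 2 - s * (1 - s) * (U + V) ^+ 2 =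
    ((1 - s) * U - s * V) ^+ 2 by exact: sqr_ge0.
  by ring.
have A' := ler_wpM2l (ltW s1) A.
have B' := ler_wpM2l (ltW s0) B.
rewrite -(ler_pM2l (mulr_gt0 s0 s1)); move: A' B' Q; lra.
Qed.

Lemma qlin_bound a b c d : `|qlin a b c d| <= mdist a b * mdist c d.
Proof.
rewrite ler_norml quadrilateral andbT lerNl.
have -> : - qlin a b c d = qlin b a c d by rewrite /qlin; field.
by rewrite (metric_sym a b) quadrilateral.
Qed.

Lemma pairing_bound f :
  exists2 M, 0 <= M & forall x y, `|pairing f x y| <= M * mdist x y.
Proof.
case: f => f fP; have /set_mem[n [al [g [gD ef]]]] := fP.
rewrite /pairing /= ef => {f fP ef}.
have gb i : exists2 M, 0 <= M & forall x y, `|g i (x, y)| <= M * mdist x y.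
  have [t [a [b ->]]] := gD i; exists (`|t| * mdist a b).
    by rewrite mulr_ge0 ?mdist_ge0.
  move=> x y; rewrite /dual_class /= normrM -mulrA ler_wpM2l //.
  exact: qlin_bound.
have [M M0 MP] := fin_all_exists2 gb.
exists (\sum_i `|al i| * M i).
  by apply: sumr_ge0 => i _; rewrite mulr_ge0.
move=> x y; rewrite fct_sumE mulr_suml (le_trans (ler_norm_sum _ _ _)) //.
apply: ler_sum => i _; rewrite /GRing.scale /= normrM -mulrA ler_wpM2l //.
Qed.

Definition dual_quotients f : set R :=
  [set q | exists a b c d, (a, c) <> (b, d) /\
    q = `|pairing f a b - pairing f c d| / (mdist a b + mdist c d)].

(* sup set0 = 0 in the library; this only matters when X is a singleton,
   and then linDual X is trivial. *)
Definition dual_norm f : R := sup (dual_quotients f).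

Lemma dist_pair_gt0 a b c d : (a, c) <> (b, d) -> 0 < mdist a b + mdist c d.
Proof.
move=> abcd; rewrite lt_neqAle addr_ge0 ?mdist_ge0 // andbT eq_sym.
apply/negP; rewrite paddr_eq0 ?mdist_ge0 // => /andP[/eqP ab /eqP cd].
by apply: abcd; rewrite (mdist_positivity _ _ ab) (mdist_positivity _ _ cd).
Qed.

Lemma dual_quotients_ubound f : has_ubound (dual_quotients f).
Proof.
have [M M0 fM] := pairing_bound f; exists M => _ [a [b [c [d [abcd ->]]]]].
rewrite ler_pdivrMr ?dist_pair_gt0 // mulrDr.
by rewrite (le_trans (ler_normB _ _)) // lerD.
Qed.

Lemma dual_norm_ub f a b c d :
  `|pairing f a b - pairing f c d| <= dual_norm f * (mdist a b + mdist c d).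
Proof.
have [[-> ->]|abcd] := pselect ((a, c) = (b, d)).
  have [M _ fM] := pairing_bound f; have := fM b b; have := fM d d.
  rewrite !mdistxx !mulr0 !normr_le0 => /eqP -> /eqP ->.
  by rewrite subrr normr0 addr0 mulr0.
rewrite -ler_pdivrMr ?dist_pair_gt0 //; apply: ub_le_sup.
  exact: dual_quotients_ubound.
by exists a, b, c, d.
Qed.

Lemma dual_norm_ge0 f : 0 <= dual_norm f.
Proof.
have [f0|/set0P[q qf]] := eqVneq (dual_quotients f) set0.
  by rewrite /dual_norm f0 sup0.
have := qf => -[a [b [c [d [_ eq]]]]].
have q0 : 0 <= q by rewrite eq divr_ge0 // addr_ge0 // mdist_ge0.
by apply: (le_trans q0); apply: ub_le_sup => //; exact: dual_quotients_ubound.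
Qed.

Lemma dual_norm_le f M : 0 <= M ->
  (forall a b c d, `|pairing f a b - pairing f c d| <=
     M * (mdist a b + mdist c d)) -> dual_norm f <= M.
Proof.
move=> M0 fM; have [f0|/set0P ne] := eqVneq (dual_quotients f) set0.
  by rewrite /dual_norm f0 sup0.
apply: ge_sup => // _ [a [b [c [d [abcd ->]]]]].
by rewrite ler_pdivrMr ?dist_pair_gt0.
Qed.

Lemma pairing_norm f x y : `|pairing f x y| <= dual_norm f * mdist x y.
Proof.
have := dual_norm_ub f x y x x; rewrite mdistxx addr0.
have [M _ fM] := pairing_bound f; have := fM x x.
by rewrite mdistxx mulr0 normr_le0 => /eqP ->; rewrite subr0.
Qed.

Lemma dual_normD f g : dual_norm (f + g) <= dual_norm f + dual_norm g.
Proof.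
apply: dual_norm_le => [|a b c d]; first by rewrite addr_ge0 ?dual_norm_ge0.
rewrite !pairingD opprD addrACA (le_trans (ler_normD _ _)) // mulrDl.
by rewrite lerD ?dual_norm_ub.
Qed.

Lemma dual_normZ_le k f : dual_norm (k *: f) <= `|k| * dual_norm f.
Proof.
apply: dual_norm_le => [|a b c d]; first by rewrite mulr_ge0 ?dual_norm_ge0.
by rewrite !pairingZ -mulrBr normrM -mulrA ler_wpM2l ?dual_norm_ub.
Qed.

Lemma dual_normZ k f : dual_norm (k *: f) = `|k| * dual_norm f.
Proof.
apply/eqP; rewrite eq_le dual_normZ_le /=.
have [->|k0] := eqVneq k 0; first by rewrite normr0 mul0r dual_norm_ge0.
have := dual_normZ_le k^-1 (k *: f).
by rewrite scalerA mulVf // scale1r normfV ler_pdivlMl ?normr_gt0.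
Qed.

Lemma dual_norm_eq0 f : dual_norm f = 0 -> f = 0.
Proof.
move=> f0; apply: linDual_ext => x y; have := pairing_norm f x y.
by rewrite f0 mul0r normr_le0 => /eqP ->.
Qed.

HB.instance Definition _ :=
  @Lmodule_isNormed.Build R (linDual X) dual_norm dual_normD dual_normZ
    dual_norm_eq0.

End DualNorm.

Section ConvexAnalysis.
Context {R : realType} {X : hadamardType R}.
Local Open Scope ereal_scope.
Implicit Types (p : X) (h : X * linDual X -> \bar R).

Definition epigraph h : set ((X * linDual X) * R) := [set za | h za.1 <= za.2%:E].

Definition proper_fun h : Prop :=
  (forall z, h z != -oo) /\ (exists z, h z != +oo).

Definition lsc h : Prop := closed (epigraph h).

Definition convex_fun h : Prop :=
  forall (x y : X) (x' y' : linDual X) (l : R), (0 <= l <= 1)%R ->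
    h (gconv l x y, (1 - l) *: x' + l *: y')%R <=
    (1 - l)%:E * h (x, x') + l%:E * h (y, y').

Definition Gamma : set (X * linDual X -> \bar R) :=
  [set h | [/\ proper_fun h, lsc h & convex_fun h]].

Definition coupling p (z : X * linDual X) : R := pairing z.2 p z.1.

Definition indicator (A : set (X * linDual X)) (z : X * linDual X) : \bar R :=
  if z \in A then 0 else +oo.

Definition sublevel_coupling p h : set (X * linDual X) :=
  [set z | h z <= (coupling p z)%:E].

Definition conjugate p h (z : linDual X * X) : \bar R :=
  ereal_sup [set (pairing z.1 p w.1)%:E + (pairing w.2 p z.2)%:E - h w
            | w in [set: X * linDual X]].

Definition swap_pair (z : X * linDual X) : linDual X * X := (z.2, z.1).

Definition Gamma_dual p : set (X * linDual X -> \bar R) :=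
  [set h | Gamma h /\
    h = conjugate p (h \+ indicator (sublevel_coupling p h)) \o swap_pair].

Definition graph (T : X -> set (linDual X)) : set (X * linDual X) :=
  [set z | T z.1 z.2].

Definition monotone_op (T : X -> set (linDual X)) : Prop :=
  forall z w, graph T z -> graph T w -> (0 <= pairing (z.2 - w.2) w.1 z.1)%R.

Definition maximal_monotone (T : X -> set (linDual X)) : Prop :=
  monotone_op T /\
  forall S, monotone_op S -> ~ (graph T `<` graph S).

Definition S_op h p (x : X) : set (linDual X) :=
  [set x' | h (x, x') = (coupling p (x, x'))%:E].

End ConvexAnalysis.

(* Main.v *)
(** Writing [F A] for the Fitzpatrick function of a set [A] of pairs, the
    difference [coupling p z - affine_minorant p w z] equals
    [pairing (z.2 - w.2) w.1 z.1], so [F A z <= coupling p z] says precisely that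
    [z] is monotonically related to every element of [A].  If [A] is the graph
    of a maximal monotone operator, this holds exactly on [A], with equality.
    Conversely, evaluating the supremum that defines [h] in [Gamma_dual p] at
    the point [z] itself gives [2 h z >= 2 coupling p z] wherever
    [h z <= coupling p z].  Hence [h >= coupling p], the sublevel set is the
    graph of [S_op h p], and [h] is the Fitzpatrick function of that graph.
    Flatness makes the affine minorants affine in the point of [X], which gives
    convexity. *)
Require Import Defs.
From mathcomp Require Import all_boot all_order all_algebra.
From mathcomp Require Import all_classical all_reals all_analysis.
From mathcomp Require Import ring lra.

Set Implicit Arguments.
Unset Strict Implicit.
Unset Printing Implicit Defensive.

Import Order.TTheory GRing.Theory Num.Theory.
Import numFieldNormedType.Exports.

(** * Additivity, affinity and continuity of the pairing *)

Section LinearDual.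
Local Open Scope classical_set_scope.
Local Open Scope ring_scope.
Context {R : realType} {X : hadamardType R}.
Implicit Types (p x y z : X) (f g : linDual X).

(** Reduces identities that are linear in the functional to the generators [qlin a b]; the scalar of
    a dual class and its coefficient merge into [k]. *)
Lemma linear_dual_ind (P : (X * X -> R) -> Prop) :
  P (fun=> 0) ->
  (forall (k : R) u v, P u -> P v -> P (fun xy => k * u xy + v xy)) ->
  (forall a b, P (fun xy => qlin a b xy.1 xy.2)) ->
  forall f : linDual X, P (fun xy => pairing f xy.1 xy.2).
Proof.
move=> P0 PD Pq [f fP]; have /set_mem[n [al [g [gD ef]]]] := fP.
have -> : (fun xy => pairing (LinDual fP) xy.1 xy.2) = \sum_(i < n) al i *: g i.
  by rewrite -ef; apply/funext => -[].
elim: n al g gD {ef} => [|n IH] al g gD; first by rewrite big_ord0.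
rewrite big_ord_recl.
have [t [a [b ->]]] := gD ord0.
apply: (eq_ind _ P
  (PD (al ord0 * t) _ _ (Pq a b) (IH _ _ (fun i => gD (lift ord0 i))))).
by apply/funext => xy; rewrite -mulrA.
Qed.

(** For [qlin a b] the squared distances to [y] cancel. This allows a change of base point. *)
Lemma pairing_chasles f x y z : pairing f x y + pairing f y z = pairing f x z.
Proof.
move: x y z.
apply: (@linear_dual_ind (fun u =>
  forall x y z, u (x, y) + u (y, z) = u (x, z)) _ _ _ f) => /=.
- by move=> *; rewrite addr0.
- by move=> k u v Hu Hv x y z; rewrite -(Hu x y z) -(Hv x y z); ring.
- by move=> a b x y z; rewrite /qlin; field.
Qed.

(** As a function of [x], [qlin a b p x] is half the difference of the squared distances to [a] and
    [b], up to a constant, so the quadratic terms of the flatness identity cancel. *)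
Lemma pairing_gconv (flatX : flat X) f p x y l : 0 <= l <= 1 ->
  pairing f p (gconv l x y) = (1 - l) * pairing f p x + l * pairing f p y.
Proof.
move=> l01.
apply: (@linear_dual_ind (fun u =>
  u (p, gconv l x y) = (1 - l) * u (p, x) + l * u (p, y)) _ _ _ f) => /=.
- by rewrite !mulr0 addr0.
- by move=> k u v -> ->; ring.
- by move=> a b; rewrite /qlin !flatX //; field.
Qed.

Lemma continuous_pairing_point f p : continuous (fun x => pairing f p x : R^o).
Proof.
move=> x; apply/(@cvgrPdist_lt _ R^o) => e e0.
(* The Lipschitz constant [dual_norm f] may vanish; adding 1 allows dividing [e] by it. *)
have M0 : 0 < dual_norm f + 1 by rewrite ltr_wpDl ?dual_norm_ge0.
have := @nbhsx_ballx R X x _ (divr_gt0 e0 M0).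
apply: filterS => y; rewrite ballEmdist /= ltr_pdivlMr // metric_sym mulrC.
rewrite -(pairing_chasles f p y x) addrAC subrr add0r.
apply: le_lt_trans; apply: (le_trans (pairing_norm _ _ _)).
by rewrite ler_wpM2r ?mdist_ge0 // lerDl.
Qed.

Lemma continuous_pairing_dual p x :
  continuous (fun f : linDual X => pairing f p x : R^o).
Proof.
move=> f; apply/(@cvgrPdist_lt _ R^o _ _ (nbhs_filter f)) => e e0.
have M0 : 0 < mdist p x + 1 by rewrite ltr_wpDl ?mdist_ge0.
have := @nbhsx_ballx R (linDual X) f _ (divr_gt0 e0 M0).
apply: (@filterS _ _ (nbhs_filter f)) => g.
rewrite -ball_normE /= ltr_pdivlMr // -pairingB.
apply: le_lt_trans; apply: (le_trans (pairing_norm _ _ _)).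
by rewrite ler_wpM2l ?dual_norm_ge0 // lerDl.
Qed.

End LinearDual.

(** * Fitzpatrick functions of sets of pairs *)

Section Fitzpatrick.
Local Open Scope classical_set_scope.
Local Open Scope ring_scope.
Context {R : realType} {X : hadamardType R}.
Implicit Types (p : X) (z w : X * linDual X) (A : set (X * linDual X)).
Implicit Types (h : X * linDual X -> \bar R) (T : X -> set (linDual X)).

(** The term that [w] contributes to the conjugate of a function agreeing with [coupling p] at
    [w]. *)
Definition affine_minorant p w z : R :=
  pairing z.2 p w.1 + pairing w.2 p z.1 - coupling p w.

Definition fitzpatrick p A z : \bar R :=
  ereal_sup [set (affine_minorant p w z)%:E | w in A].

Lemma coupling_sub_affine_minorant p w z :
  coupling p z - affine_minorant p w z = pairing (z.2 - w.2) w.1 z.1.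
Proof.
rewrite /affine_minorant /coupling pairingB.
rewrite -(pairing_chasles z.2 p w.1 z.1) -(pairing_chasles w.2 p w.1 z.1).
by ring.
Qed.

Lemma affine_minorant_diag p z : affine_minorant p z z = coupling p z.
Proof. by rewrite /affine_minorant /coupling addrK. Qed.

Lemma fitzpatrick_le_coupling p A z :
  (fitzpatrick p A z <= (coupling p z)%:E)%E <->
  forall w, A w -> 0 <= pairing (z.2 - w.2) w.1 z.1.
Proof.
split=> [le w Aw|ge0].
  rewrite -(coupling_sub_affine_minorant p) subr_ge0 -lee_fin.
  by apply: le_trans le; apply: ereal_sup_ubound; exists w.
apply: ge_ereal_sup => _ [w Aw <-].
by rewrite lee_fin -subr_ge0 coupling_sub_affine_minorant ge0.
Qed.

Lemma coupling_le_fitzpatrick p A z : A z ->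
  ((coupling p z)%:E <= fitzpatrick p A z)%E.
Proof.
by move=> Az; apply: ereal_sup_ubound; exists z; rewrite ?affine_minorant_diag.
Qed.

Lemma conjugate_indicator p h A :
  (forall z, h z != -oo%E) ->
  (forall w, A w -> h w = (coupling p w)%:E) ->
  conjugate p (h \+ indicator A)%E \o swap_pair = fitzpatrick p A.
Proof.
move=> hNy hA; apply/funext => z /=; apply/eqP; rewrite eq_le; apply/andP; split.
  apply: ge_ereal_sup => _ [w _ <-]; rewrite /indicator.
  case: ifPn => [/set_mem Aw|_].
    by rewrite adde0 hA //; apply: ereal_sup_ubound; exists w.
  (* Off [A] the penalized function is [+oo], because [h w] is not [-oo]; the term is then [-oo]. *)
  by rewrite addey // leNye.
apply: ge_ereal_sup => _ [w Aw <-]; apply: ereal_sup_ubound; exists w => //.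
by rewrite /indicator mem_set // adde0 hA.
Qed.

Lemma continuous_affine_minorant p w :
  continuous (fun z => affine_minorant p w z : R^o).
Proof.
move=> z; apply: (@cvgB _ R^o _ _ (nbhs_filter z)); last exact: cvg_cst.
apply: (@cvgD _ R^o _ _ (nbhs_filter z)).
  apply: (@continuous_comp _ _ _ snd (fun f => pairing f p w.1 : R^o)).
    exact: (@cvg_snd _ _ _ _ (nbhs_filter _)).
  exact: continuous_pairing_dual.
apply: (@continuous_comp _ _ _ fst (fun x => pairing w.2 p x : R^o)).
  exact: (@cvg_fst _ _ _ _ (nbhs_filter _)).
exact: continuous_pairing_point.
Qed.

(** The epigraph of a supremum is the intersection of the epigraphs, here of continuous
    functions. *)
Lemma lsc_fitzpatrick p A : lsc (fitzpatrick p A).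
Proof.
rewrite /lsc; have -> : epigraph (fitzpatrick p A) =
    \bigcap_(w in A) [set za | 0 <= za.2 - affine_minorant p w za.1].
  apply/seteqP; split=> [[z a] /= le w Aw|[z a] /= le].
    rewrite /= subr_ge0 -lee_fin; apply: le_trans le.
    by apply: ereal_sup_ubound; exists w.
  apply: ge_ereal_sup => _ [w Aw <-].
  by rewrite lee_fin -subr_ge0; exact: le Aw.
apply: closed_bigI => w Aw.
apply: (@preimage_closed _ R^o
  (fun za => za.2 - affine_minorant p w za.1) [set x : R^o | 0 <= x]).
  move=> za _; apply: (@cvgB _ R^o _ _ (nbhs_filter za)).
    exact: (@cvg_snd _ _ _ _ (nbhs_filter _)).
  apply: (@continuous_comp _ _ _ fst (fun z => affine_minorant p w z : R^o)).
    exact: (@cvg_fst _ _ _ _ (nbhs_filter _)).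
  exact: continuous_affine_minorant.
exact: closed_ge.
Qed.

Lemma affine_minorant_gconv (flatX : flat X) p w x y (x' y' : linDual X) l :
  0 <= l <= 1 ->
  affine_minorant p w (gconv l x y, (1 - l) *: x' + l *: y') =
  (1 - l) * affine_minorant p w (x, x') + l * affine_minorant p w (y, y').
Proof.
move=> l01.
rewrite {1}/affine_minorant [X in _ + X - _]pairing_gconv // pairingD !pairingZ.
by rewrite /affine_minorant; ring.
Qed.

Lemma convex_fitzpatrick (flatX : flat X) p A : convex_fun (fitzpatrick p A).
Proof.
move=> x y x' y' l l01; apply: ge_ereal_sup => _ [w Aw <-].
rewrite affine_minorant_gconv // EFinD !EFinM.
have /andP[l0 l1] := l01.
apply: leeD; apply: lee_wpmul2l; rewrite ?lee_fin ?subr_ge0 //;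
  by apply: ereal_sup_ubound; exists w.
Qed.

(** * Rigidity of the members of [Gamma_dual p] *)

Lemma Gamma_dual_ge_coupling p h z :
  Gamma_dual p h -> ((coupling p z)%:E <= h z)%E.
Proof.
move=> [[[hNy _] _ _] hE]; case: (leP (h z) (coupling p z)%:E) => [le|/ltW //].
have : ((coupling p z)%:E + (coupling p z)%:E - h z <= h z)%E.
  rewrite {2}hE; apply: ereal_sup_ubound; exists z => //=.
  by rewrite /indicator mem_set // adde0.
(* Properness excludes [-oo] and [le] excludes [+oo], so the inequality can be solved for a real
   value [r]. *)
move: (hNy z) le; case: (h z) => [r||] // _.
by rewrite -!EFinD !lee_fin; lra.
Qed.

Lemma sublevel_couplingE p h : Gamma_dual p h ->
  sublevel_coupling p h = graph (S_op h p).
Proof.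
move=> hG; apply/seteqP; split=> -[x x'] le.
  by apply/eqP; rewrite eq_le le Gamma_dual_ge_coupling.
by rewrite /sublevel_coupling /= (le : h (x, x') = _).
Qed.

(** Recovers [h] from its operator alone, which yields uniqueness. *)
Lemma Gamma_dual_fitzpatrick p h : Gamma_dual p h ->
  h = fitzpatrick p (graph (S_op h p)).
Proof.
move=> hG; have [[[hNy _] _ _] hE] := hG.
rewrite {1}hE sublevel_couplingE //; apply: conjugate_indicator => //.
by case.
Qed.

(** * Maximal monotone operators and their Fitzpatrick functions *)

Lemma monotone_graph_le_coupling p T z : monotone_op T -> graph T z ->
  (fitzpatrick p (graph T) z <= (coupling p z)%:E)%E.
Proof. by move=> mT Tz; apply/fitzpatrick_le_coupling => w; exact: mT. Qed.

(** Maximality can be tested one pair at a time: adjoining a pair related to the whole graph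
    preserves monotonicity. *)
Lemma maximal_monotoneP T : maximal_monotone T <->
  monotone_op T /\ forall z,
    (forall w, graph T w -> 0 <= pairing (z.2 - w.2) w.1 z.1) -> graph T z.
Proof.
(* Expanded from a base point, the expression is symmetric in [z] and [w]; any base point serves,
   hence [point]. *)
have flip (z w : X * linDual X) :
    pairing (w.2 - z.2) z.1 w.1 = pairing (z.2 - w.2) w.1 z.1.
  rewrite -!(coupling_sub_affine_minorant point) /affine_minorant /coupling.
  by ring.
have diag (z : X * linDual X) : 0 <= pairing (z.2 - z.2) z.1 z.1.
  by rewrite subrr.
split=> [[mT maxT]|[mT maxT]]; split=> //.
- move=> z zT; apply: contrapT => nTz.
  pose S x := [set x' | T x x' \/ (x, x') = z].
  apply: (maxT S); last first.
    split=> [[x x'] Tx|ST]; first by left.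
    by apply/nTz/ST; right; case: (z).
  move=> [x x'] [y y'] [Tx|->] [Ty|->].
  + exact: (mT (x, x') (y, y')).
  + by rewrite flip; exact: zT (x, x') Tx.
  + exact: zT (y, y') Ty.
  + exact: diag.
- move=> S mS [TS]; apply=> z Sz; apply: maxT => w Tw.
  by apply: mS => //; exact: TS.
Qed.

Section MaximalMonotone.
Variables (p : X) (T : X -> set (linDual X)).
Hypothesis maxT : maximal_monotone T.

Lemma fitzpatrick_maximal z :
  (fitzpatrick p (graph T) z <= (coupling p z)%:E)%E <-> graph T z.
Proof.
have [mT clT] := (maximal_monotoneP T).1 maxT.
split; last exact: monotone_graph_le_coupling.
by move=> /fitzpatrick_le_coupling; exact: clT.
Qed.

Lemma fitzpatrick_maximal_eq z :
  fitzpatrick p (graph T) z = (coupling p z)%:E <-> graph T z.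
Proof.
split=> [eq|Tz]; first by apply/fitzpatrick_maximal; rewrite eq.
apply/eqP; rewrite eq_le coupling_le_fitzpatrick // andbT.
exact/fitzpatrick_maximal.
Qed.

(** Every pair is vacuously related to an empty graph. Nonemptiness makes the Fitzpatrick function
    proper, as a supremum over the empty set is [-oo]. *)
Lemma graph_maximal_nonempty : graph T !=set0.
Proof.
have [_ clT] := (maximal_monotoneP T).1 maxT.
apply/set0P/eqP => T0.
have : graph T (p, 0) by apply: clT => w; rewrite T0.
by rewrite T0.
Qed.

Lemma S_op_fitzpatrick : S_op (fitzpatrick p (graph T)) p = T.
Proof.
apply/funext => x; apply/seteqP.
by split=> x'; rewrite /S_op /= fitzpatrick_maximal_eq.
Qed.

Lemma Gamma_dual_fitzpatrick_maximal (flatX : flat X) :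
  Gamma_dual p (fitzpatrick p (graph T)).
Proof.
have [z0 Tz0] := graph_maximal_nonempty.
have fNy z : fitzpatrick p (graph T) z != -oo%E.
  rewrite -ltNye; apply: (@lt_le_trans _ _ (affine_minorant p z0 z)%:E).
    exact: ltNyr.
  by apply: ereal_sup_ubound; exists z0.
split.
  split; [split=> //|exact: lsc_fitzpatrick|exact: convex_fitzpatrick].
  by exists z0; rewrite (fitzpatrick_maximal_eq z0).2.
(* With this equality the fixed-point equation becomes an instance of [conjugate_indicator]. *)
have -> : sublevel_coupling p (fitzpatrick p (graph T)) = graph T.
  by apply/seteqP; split=> z /fitzpatrick_maximal.
by rewrite conjugate_indicator // => w /fitzpatrick_maximal_eq.
Qed.

End MaximalMonotone.

(** The sublevel set of [h] is the graph of its operator and, [h] being the Fitzpatrick function of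
    that graph, also the set of pairs related to all of it. One inclusion is monotonicity, the other
    maximality. *)
Lemma maximal_monotone_S_op p h :
  Gamma_dual p h -> maximal_monotone (S_op h p).
Proof.
move=> hG; have hE := Gamma_dual_fitzpatrick hG.
apply/maximal_monotoneP; split=> [z w hz hw|z zT].
  have : (fitzpatrick p (graph (S_op h p)) z <= (coupling p z)%:E)%E.
    by rewrite -hE; move: hz; rewrite -sublevel_couplingE.
  by move=> /fitzpatrick_le_coupling; exact.
by rewrite -sublevel_couplingE // /sublevel_coupling /= hE;
  exact/fitzpatrick_le_coupling.
Qed.

End Fitzpatrick.

Theorem corollary5p16 (R : realType) (X : hadamardType R) (flatX : flat X)
    (p : X) (T : X -> set (linDual X)) :
  maximal_monotone T <->
  exists! h : X * linDual X -> \bar R, Gamma_dual p h /\ T = S_op h p.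
Proof.
split=> [maxT|[h [[hG ->] _]]]; last exact: maximal_monotone_S_op.
exists (fitzpatrick p (graph T)); split.
  by split; [exact: Gamma_dual_fitzpatrick_maximal|rewrite S_op_fitzpatrick].
by move=> h [hG ->]; rewrite -Gamma_dual_fitzpatrick.
Qed.
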